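(* Let $\mathcal A$ and $\mathcal B$ be two commutative semisimple Banach algebras and let $\phi:\mathcal B\to\mathcal A$ be a contractive algebra homomorphism. Then $\mathcal A\times_\phi\mathcal B$ is a BSE-algebra if and only if $\mathcal A$ and $\mathcal B$ are BSE-algebras.
   Context: For a contractive algebra homomorphism $\phi:\mathcal B\to\mathcal A$ between Banach algebras, the $\phi$-Lau product $\mathcal A\times_\phi\mathcal B$ is the space $\mathcal A\times\mathcal B$ with norm $\|(a,b)\|=\|a\|+\|b\|$ and product $(a,b)(a',b')=(aa'+\phi(b)a'+a\phi(b'),\,bb')$. For a commutative Banach algebra $\mathcal C$, $\Delta(\mathcal C)$ is its carrier space (nonzero multiplicative linear functionals, with the Gelfand topology), and $\mathcal C$ is without order if $c\,\mathcal C=\{0\}$ implies $c=0$ (commutative semisimple algebras are without order). $C_{BSE}(\Delta(\mathcal C))$ is the set of continuous complex-valued functions $\sigma$ on $\Delta(\mathcal C)$ for which there is a constant $C>0$ with $\left|\sum_{j=1}^n c_j\sigma(\varphi_j)\right|\le C\left\|\sum_{j=1}^n c_j\varphi_j\right\|_{\mathcal C^*}$ for all $n$, all $\varphi_1,\dots,\varphi_n\in\Delta(\mathcal C)$ and all $c_1,\dots,c_n\in\mathbb C$. $M(\mathcal C)$ is the set of multipliers, i.e. linear operators $T$ on $\mathcal C$ with $cT(b)=T(c)b$ for all $b,c\in\mathcal C$; for $T\in M(\mathcal C)$, $\widehat T$ is the unique continuous function on $\Delta(\mathcal C)$ with $\varphi(T(c))=\widehat T(\varphi)\varphi(c)$ for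 all $c\in\mathcal C$, $\varphi\in\Delta(\mathcal C)$, and $\widehat{M(\mathcal C)}=\{\widehat T:T\in M(\mathcal C)\}$. A commutative Banach algebra $\mathcal C$ without order is a BSE-algebra if $C_{BSE}(\Delta(\mathcal C))=\widehat{M(\mathcal C)}$. *)

(* Defs.v *)
From HB Require Import structures.
From mathcomp Require Import all_boot all_order all_algebra.
From mathcomp Require Import all_classical all_reals all_analysis.
From mathcomp Require Import complex.

Set Implicit Arguments.
Unset Strict Implicit.
Unset Printing Implicit Defensive.

Import Order.TTheory GRing.Theory Num.Theory.
Import numFieldNormedType.Exports.

Local Open Scope classical_set_scope.
Local Open Scope ring_scope.

(* Banach algebras are not assumed to be unital, so the product is kept
   separate from the (unital) ring structures of MathComp. *)
HB.mixin Record isBanachAlgebra (K : numFieldType) V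
    of CompleteNormedModule K V := {
  bmul : V -> V -> V ;
  bmulA : associative bmul ;
  bmulDl : left_distributive bmul +%R ;
  bmulDr : right_distributive bmul +%R ;
  bmulZl : forall (k : K) x y, bmul (k *: x) y = k *: bmul x y ;
  bmulZr : forall (k : K) x y, bmul x (k *: y) = k *: bmul x y ;
  ler_normbM : forall x y, `|bmul x y| <= `|x| * `|y|
}.

#[short(type="banachAlgType")]
HB.structure Definition BanachAlgebra (K : numFieldType) :=
  {V of CompleteNormedModule K V & isBanachAlgebra K V}.

Record contractive_hom (K : numFieldType) (B A : banachAlgType K) := ContractiveHom {
  chom :> {linear B -> A} ;
  chomM : {morph chom : b b' / bmul b b' >-> bmul b b'} ;
  ler_chom : forall b, `|chom b| <= `|b|
}.

(* An alias of A * B: the normed module structure that MathComp-Analysis puts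
   on A * B itself is that of the max norm. *)
Definition lau (K : numFieldType) (A B : banachAlgType K)
  (phi : contractive_hom B A) : Type := (A * B)%type.

Section lau.
Context (K : numFieldType) (A B : banachAlgType K) (phi : contractive_hom B A).
Local Notation L := (lau phi).

HB.instance Definition _ := GRing.Lmodule.copy L (A * B)%type.

Definition lau_norm (x : L) : K := `|x.1| + `|x.2|.

Let lau_normD (x y : L) : lau_norm (x + y) <= lau_norm x + lau_norm y.
Proof. by rewrite /lau_norm addrACA lerD ?ler_normD. Qed.

Let lau_normZ (l : K) (x : L) : lau_norm (l *: x) = `|l| * lau_norm x.
Proof. by rewrite /lau_norm/= !normrZ mulrDr. Qed.

Let lau_norm_eq0 (x : L) : lau_norm x = 0 -> x = 0.
Proof.
case: x => a b /eqP; rewrite /lau_norm paddr_eq0//= => /andP[].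
by rewrite !normr_eq0 => /eqP-> /eqP->.
Qed.

HB.instance Definition _ := Lmodule_isNormed.Build K L
  lau_normD lau_normZ lau_norm_eq0.

Let lau_normE (x : L) : `|x| = `|x.1| + `|x.2|.
Proof. by []. Qed.

Let lau_complete (F : set_system L) : ProperFilter F -> cauchy F -> cvg F.
Proof.
move=> FF /cauchy_ballP Fc.
have near_pair (e : K) : 0 < e -> \forall x & y \near F, `|x - y : L| < e.
  by move=> e0; have := Fc _ e0; rewrite -ball_normE.
have c1 : cauchy ((fun x : L => x.1) @ F).
  apply/(iffLR (cauchy_ballP _)).
  move=> e e0; rewrite near_map2; move: (near_pair e e0); apply: (@filterS _ (filter_prod F F)) => -[x y] /=.
  rewrite -ball_normE /=.
  by apply: le_lt_trans; rewrite lau_normE/= lerDl.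
have c2 : cauchy ((fun x : L => x.2) @ F).
  apply/(iffLR (cauchy_ballP _)).
  move=> e e0; rewrite near_map2; move: (near_pair e e0); apply: (@filterS _ (filter_prod F F)) => -[x y] /=.
  rewrite -ball_normE /=.
  by apply: le_lt_trans; rewrite lau_normE/= lerDr.
have [a Fa] : exists a : A, (fun x : L => x.1) @ F --> a.
  by apply/cvg_ex; exact: cauchy_cvg.
have [b Fb] : exists b : B, (fun x : L => x.2) @ F --> b.
  by apply/cvg_ex; exact: cauchy_cvg.
apply/cvg_ex; exists ((a, b) : L); apply/cvgrPdist_lt => e e0.
have e20 : 0 < e / 2 by rewrite divr_gt0.
move/cvgrPdist_lt : Fa => /(_ _ e20) Fa; move/cvgrPdist_lt : Fb => /(_ _ e20) Fb.
near=> x; rewrite lau_normE/= (splitr e) ltrD//; first by near: x; exact: Fa.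
by near: x; exact: Fb.
Unshelve. all: by end_near. Qed.

HB.instance Definition _ := Uniform_isComplete.Build L lau_complete.

Definition lau_mul (x y : L) : L :=
  (bmul x.1 y.1 + bmul (phi x.2) y.1 + bmul x.1 (phi y.2), bmul x.2 y.2).

Let lau_mulE (x y : L) : lau_mul x y =
  (bmul (x.1 + phi x.2) (y.1 + phi y.2) - bmul (phi x.2) (phi y.2), bmul x.2 y.2).
Proof.
congr pair; rewrite bmulDl !bmulDr !addrA addrK.
by rewrite -!addrA; congr (_ + _); rewrite addrC.
Qed.

Let lau_mulK (x y : L) :
  (lau_mul x y).1 + phi (lau_mul x y).2 = bmul (x.1 + phi x.2) (y.1 + phi y.2).
Proof. by rewrite lau_mulE/= chomM subrK. Qed.

Let lau_mulA : associative lau_mul.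
Proof.
move=> x y z; rewrite lau_mulE [RHS]lau_mulE !lau_mulK.
by rewrite !bmulA /= !chomM !bmulA.
Qed.

Let lau_mulDl : left_distributive lau_mul +%R.
Proof.
move=> x y z; congr pair => /=; last by rewrite bmulDl.
by rewrite linearD !bmulDl [RHS]addrACA; congr (_ + _); rewrite addrACA.
Qed.

Let lau_mulDr : right_distributive lau_mul +%R.
Proof.
move=> x y z; congr pair => /=; last by rewrite bmulDr.
by rewrite linearD !bmulDr [RHS]addrACA; congr (_ + _); rewrite addrACA.
Qed.

Let lau_mulZl (k : K) (x y : L) : lau_mul (k *: x) y = k *: lau_mul x y.
Proof. by congr pair => /=; rewrite ?linearZ/= !bmulZl// !scalerDr. Qed.

Let lau_mulZr (k : K) (x y : L) : lau_mul x (k *: y) = k *: lau_mul x y.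
Proof. by congr pair => /=; rewrite ?linearZ/= !bmulZr// !scalerDr. Qed.

Let lau_normM (x y : L) : `|lau_mul x y| <= `|x| * `|y|.
Proof.
rewrite !lau_normE /= mulrDl !mulrDr addrA.
rewrite lerD ?ler_normbM// (le_trans (ler_normD _ _))//.
rewrite [leRHS]addrAC lerD//; last first.
  by rewrite (le_trans (ler_normbM _ _))// ler_wpM2l// ler_chom.
rewrite (le_trans (ler_normD _ _))// lerD ?ler_normbM//.
by rewrite (le_trans (ler_normbM _ _))// ler_wpM2r// ler_chom.
Qed.

HB.instance Definition _ := isBanachAlgebra.Build K L
  lau_mulA lau_mulDl lau_mulDr lau_mulZl lau_mulZr lau_normM.

End lau.

(* Norms of complex numbers, and of vectors of a complex normed module, are
   elements of R[i] with zero imaginary part; [complex.Re] turns them into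
   elements of R. *)
Section BSE.
Context (R : realType) (C : banachAlgType R[i]).

(* The topology of a subset of {ptws C -> R[i]^o} is that of pointwise
   convergence on C. Continuity is not required: multiplicative linear
   functionals on a Banach algebra are automatically contractive. *)
Definition carrier_space : Type :=
  set_type [set f : {ptws C -> R[i]^o} |
    [/\ scalar (f : C -> R[i]),
        {morph (f : C -> R[i]) : x y / bmul x y >-> x * y} &
        exists x, f x != 0]].

HB.instance Definition _ := Topological.on carrier_space.

Definition char_val (f : carrier_space) : C -> R[i] := set_val f.

(* The radical of a commutative Banach algebra is the intersection of the
   kernels of its characters. *)
Definition semisimple :=
  forall c : C, (forall f : carrier_space, char_val f c = 0) -> c = 0.

Definition without_order :=
  forall c : C, (forall b : C, bmul c b = 0) -> c = 0.

Definition dual_norm (f : C -> R[i]) : \bar R :=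
  ereal_sup [set (complex.Re `|f x|)%:E | x in [set x : C | `|x| <= 1]].

Definition C_BSE : set (carrier_space -> R[i]) :=
  [set s | continuous (s : carrier_space -> R[i]^o) /\
    exists2 k : R, 0 < k &
      forall (n : nat) (f : 'I_n -> carrier_space) (c : 'I_n -> R[i]),
        ((complex.Re `|\sum_(j < n) c j * s (f j)|)%:E <=
         k%:E * dual_norm (fun x => \sum_(j < n) c j * char_val (f j) x)%R)%E].

Definition multiplier (T : {linear C -> C}) :=
  forall b c : C, bmul c (T b) = bmul (T c) b.

(* Such an s is unique, since no element of the carrier space vanishes
   identically. *)
Definition is_multiplier_transform (T : {linear C -> C})
    (s : carrier_space -> R[i]) :=
  continuous (s : carrier_space -> R[i]^o) /\
  forall (c : C) (f : carrier_space), char_val f (T c) = s f * char_val f c.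

Definition multiplier_transforms : set (carrier_space -> R[i]) :=
  [set s | exists2 T : {linear C -> C},
             multiplier T & is_multiplier_transform T s].

Definition BSE_algebra :=
  [/\ commutative (@bmul R[i] C), without_order &
      C_BSE = multiplier_transforms].

End BSE.

Arguments semisimple {R} C.
Arguments without_order {R} C.
Arguments C_BSE {R} C.
Arguments multiplier_transforms {R} C.
Arguments BSE_algebra {R} C.

(* Main.v *)
Require Import Defs.
From HB Require Import structures.
From mathcomp Require Import all_boot all_order all_algebra.
From mathcomp Require Import all_classical all_reals all_analysis.
From mathcomp Require Import complex.
Set Implicit Arguments.
Unset Strict Implicit.
Unset Printing Implicit Defensive.
Import Order.TTheory GRing.Theory Num.Theory.
Import numFieldNormedType.Exports.
Local Open Scope classical_set_scope.
Local Open Scope ring_scope.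

(** The map (a, b) |-> (a + phi b, b) is an isomorphism of algebras from
    L = lau phi onto the direct product of A and B with the coordinatewise
    product, and it is bicontinuous. So L behaves, for everything that the BSE
    property involves, like a direct sum of A and B.

    In detail, every character of L is either f (a + phi b) for a unique
    character f of A, or g b for a unique character g of B ([lau_char_inj],
    [lau_char_surj]), and the two families are disjoint, open and carry the
    topologies of the carrier spaces of A and B ([lau_continuousP]). A function
    on the carrier space of L is thus a pair of functions, one on that of A and
    one on that of B, and both sides of the BSE equality can be read off the
    pair:
    - it satisfies a BSE inequality iff its two components do ([C_BSE_lauP]).
      The constants change by a bounded factor, because a |-> (a, 0) and
      b |-> (- phi b, b), which isolate the two families of characters, have
      norms at most 1 and 2, whereas (a, b) |-> a + phi b and (a, b) |-> b are
      contractive;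
    - it is the transform of a multiplier iff its two components are
      ([multiplier_transforms_lauP]): a multiplier of L is conjugate to a pair
      of multipliers. Semisimplicity makes this an exercise in characters, since
      an operator that acts on characters by multiplication is then
      automatically a multiplier ([char_multiplier]).
    Hence L is BSE as soon as A and B are. Conversely, a function on one of the
    two carrier spaces extends by 0 to the carrier space of L, and the function
    0 is both in C_BSE and a multiplier transform, so the BSE equality for L
    gives the equality for each of A and B. *)

(** * Characters *)

Section carrier_space_theory.
Context (R : realType) (C : banachAlgType R[i]).
Implicit Types (f : carrier_space C).

Lemma carrier_spaceP f :
  [/\ scalar (char_val f),
      {morph char_val f : x y / bmul x y >-> x * y} &
      exists x, char_val f x != 0].
Proof. exact: set_mem (svalP f). Qed.

Lemma charM f x y : char_val f (bmul x y) = char_val f x * char_val f y.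
Proof. by have [_ + _] := carrier_spaceP f; exact. Qed.

Lemma char_neq0 f : exists x, char_val f x != 0.
Proof. by have [] := carrier_spaceP f. Qed.

Lemma char_scalar f : scalar (char_val f).
Proof. by have [] := carrier_spaceP f. Qed.

HB.instance Definition _ f := GRing.isLinear.Build R[i] C R[i] *%R (char_val f)
  (char_scalar f).

Definition mk_char (u : C -> R[i]) (lu : scalar u)
    (mu : {morph u : x y / bmul x y >-> x * y}) (nu : exists x, u x != 0) :
  carrier_space C := exist _ (u : {ptws C -> R[i]^o}) (mem_set (And3 lu mu nu)).

Lemma char_inj : injective (@char_val R C).
Proof. by move=> f g fg; exact: val_inj. Qed.

(** The carrier space carries the topology of pointwise convergence, as the
    initial topology for its inclusion in a function space; the inclusion is not
    surjective, so the convergence criterion goes through basic open sets. *)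
Lemma cvg_carrier (T : Type) (F : set_system T) (FF : Filter F)
    (u : T -> carrier_space C) f :
  (forall c, (char_val (u t) c : R[i]^o) @[t --> F] --> (char_val f c : R[i]^o)) ->
  u @ F --> f.
Proof.
move=> uf.
have {uf} : {ptws, (fun t => (char_val (u t) : {ptws C -> R[i]^o})) @ F -->
    (char_val f : {ptws C -> R[i]^o})}.
  by apply/(pointwise_cvgP (V := R[i]^o)).
move=> uf U [/= _ [[W oW <-]] /= Wf] /filterS; apply; apply: uf.
exact: open_nbhs_nbhs.
Qed.

Lemma char_val_continuous (c : C) :
  continuous ((fun f => char_val f c) : carrier_space C -> R[i]^o).
Proof.
move=> f; apply: (@cvg_comp _ _ _ (fun f => char_val f : {ptws C -> R[i]^o})
  (fun v : {ptws C -> R[i]^o} => v c) _ (nbhs (char_val f : {ptws C -> R[i]^o}))).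
  exact: initial_continuous.
by move: (c); apply/(pointwise_cvgP (V := R[i]^o)); exact: cvg_id.
Qed.

End carrier_space_theory.

(** * Dual norms and the BSE inequality *)

Section BSE_inequality.
Context (R : realType).

Lemma Re_normZ (r : R) (z : R[i]) : 0 <= r ->
  complex.Re `|r%:C%C * z| = r * complex.Re `|z|.
Proof.
move=> r0; rewrite normrM ger0_norm ?lecR//.
by case: `|z| => a b /=; rewrite mul0r subr0.
Qed.

Lemma Re_normD (u v : R[i]) : complex.Re `|u + v| <= complex.Re `|u| + complex.Re `|v|.
Proof.
have := ler_normD u v; rewrite lecE => /andP[_] /le_trans; apply.
by case: `|u|; case: `|v|.
Qed.

Lemma dual_norm_ge0 (C : banachAlgType R[i]) (u : C -> R[i]) : (0 <= dual_norm u)%E.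
Proof.
apply: (@le_trans _ _ (complex.Re `|u 0|)%:E).
  by rewrite lee_fin; have := normr_ge0 (u 0); rewrite lecE => /andP[].
by apply: ereal_sup_ubound; exists 0 => //=; rewrite normr0 ler01.
Qed.

(** The workhorse for comparing dual norms on different algebras: a functional
    that factors through a contraction w has a norm controlled by that of the
    other factor. The scalar r allows for maps of norm r, rescaled to
    contractions. *)
Lemma le_dual_norm (C D : banachAlgType R[i]) (r : R) (w : C -> D)
    (u : C -> R[i]) (v : D -> R[i]) :
  0 < r -> (forall x, `|w x| <= `|x|) -> (forall x, u x = r%:C%C * v (w x)) ->
  (dual_norm u <= r%:E * dual_norm v)%E.
Proof.
move=> r0 w1 uv; apply: ub_ereal_sup => _ [x x1 <-].
rewrite uv Re_normZ ?(ltW r0)// EFinM lee_pmul2l// .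
by apply: ereal_sup_ubound; exists (w x) => //; exact: le_trans x1.
Qed.

Definition BSE_bound (C : banachAlgType R[i]) (s : carrier_space C -> R[i]) (k : R) :=
  forall (n : nat) (f : 'I_n -> carrier_space C) (c : 'I_n -> R[i]),
    ((complex.Re `|\sum_(j < n) c j * s (f j)|)%:E <=
     k%:E * dual_norm (fun x => \sum_(j < n) c j * char_val (f j) x)%R)%E.

(** Restricting a finite family of characters to a subfamily keeps the BSE
    inequality; the discarded positions are marked by None. They are filled with
    an arbitrary character and coefficient 0, and when no character exists at
    all every position is discarded and the sum is 0. *)
Lemma BSE_bound_option (C : banachAlgType R[i]) (s : carrier_space C -> R[i])
    (k : R) (n : nat) (f : 'I_n -> option (carrier_space C)) (c : 'I_n -> R[i]) :
  0 < k -> BSE_bound s k ->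
  ((complex.Re `|\sum_(j < n) c j * oapp s 0 (f j)|)%:E <=
   k%:E * dual_norm (fun x => \sum_(j < n) c j * oapp (@char_val R C ^~ x) 0 (f j))%R)%E.
Proof.
move=> k0 sk; have [[f0]|nf] := pselect (inhabited (carrier_space C)).
  have := sk n (fun j => odflt f0 (f j)) (fun j => if f j then c j else 0).
  rewrite (eq_bigr (fun j => c j * oapp s 0 (f j))); last first.
    by move=> j _; case: (f j) => [g|]//=; rewrite mul0r mulr0.
  congr (_ <= _ * dual_norm _)%E; apply/funext => x; apply: eq_bigr => j _.
  by case: (f j) => [g|]//=; rewrite mul0r mulr0.
rewrite big1 => [|j _].
  by rewrite normr0/= mule_ge0 ?dual_norm_ge0// lee_fin ltW.
by case: (f j) => [g|]; rewrite ?mulr0//; case: nf.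
Qed.

End BSE_inequality.

(** * Semisimple algebras and their multipliers *)

Section banach_algebra_theory.
Context (R : realType) (C : banachAlgType R[i]).

Lemma bmul0l (x : C) : bmul 0 x = 0.
Proof. by rewrite -(scale0r (0 : C)) bmulZl !scale0r. Qed.

Lemma bmul0r (x : C) : bmul x 0 = 0.
Proof. by rewrite -(scale0r (0 : C)) bmulZr !scale0r. Qed.

Lemma semisimple_eq (ss : semisimple C) (x y : C) :
  (forall f, char_val f x = char_val f y) -> x = y.
Proof.
by move=> xy; apply: subr0_eq; apply: ss => f; rewrite linearB /= xy subrr.
Qed.

(** If c annihilates the algebra then c c = 0, so every character kills c. *)
Lemma semisimple_without_order : semisimple C -> without_order C.
Proof.
move=> ss c c0; apply: ss => f; apply/eqP; rewrite -sqrf_eq0 expr2 -charM c0.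
by rewrite linear0.
Qed.

(** Both sides of the multiplier identity have the same value, s f (f b) (f c),
    at each character f. *)
Lemma char_multiplier (ss : semisimple C) (T : {linear C -> C})
    (s : carrier_space C -> R[i]) :
  (forall c f, char_val f (T c) = s f * char_val f c) -> multiplier T.
Proof.
move=> Ts b c; apply: (semisimple_eq ss) => f.
by rewrite !charM !Ts mulrCA mulrA.
Qed.

Lemma multiplier_transforms0 : multiplier_transforms C (fun=> 0).
Proof.
exists (GRing.null_fun C : {linear C -> C}).
  by move=> b c; rewrite /= bmul0l bmul0r.
split => [f|c f]; first exact: cst_continuous.
by rewrite mul0r linear0.
Qed.

Lemma C_BSE0 : C_BSE C (fun=> 0).
Proof.
split => [f|]; first exact: cst_continuous.
exists 1 => // n f c; rewrite big1 => [|j _]; last by rewrite mulr0.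
by rewrite normr0 mule_ge0 ?dual_norm_ge0.
Qed.

End banach_algebra_theory.

(** * Embeddings of carrier spaces *)

Section embedding.
Context (R : realType) (C D : banachAlgType R[i]).

Lemma near_char_neq0 (h : carrier_space D) (x : D) :
  char_val h x != 0 -> \forall h' \near h, char_val h' x != 0.
Proof.
exact: cvgr_neq0 (@char_val_continuous _ _ x h).
Qed.

(** A map i of carrier spaces that has a transposed inverse j is a homeomorphism
    onto its range, and the range is open when every character outside of it
    vanishes on the range of j: near i f the value at some j c stays nonzero.
    So continuity of s at i f can be tested on the source of i. *)
Lemma continuous_at_embedded (i : carrier_space C -> carrier_space D) (j : C -> D)
    (s : carrier_space D -> R[i]^o) (f : carrier_space C) :
  (forall f c, char_val (i f) (j c) = char_val f c) ->
  (forall h, (exists f, i f = h) \/ (forall c, char_val h (j c) = 0)) ->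
  {for f, continuous (s \o i)} -> {for i f, continuous s}.
Proof.
move=> ij split_h cs.
have near_i : \forall h \near i f, exists f', i f' = h.
  have [c fc] := char_neq0 f; rewrite -ij in fc.
  apply: filterS (near_char_neq0 fc) => h hc.
  by case: (split_h h) => // /(_ c) h0; rewrite h0 eqxx in hc.
(* A local inverse of i, with f as a default value outside of the range of i. *)
pose rho h := if pselect (exists f', i f' = h) is left e then sval (cid e) else f.
have rhoK h : (exists f', i f' = h) -> i (rho h) = h.
  by rewrite /rho; case: pselect => // e _; exact: svalP (cid e).
have crho : rho @ i f --> f.
  apply: (cvg_carrier (nbhs_filter (i f))) => c; rewrite -ij.
  apply: cvg_trans (@char_val_continuous _ _ (j c) (i f)).
  by apply: near_eq_cvg; apply: filterS near_i => h /rhoK ih; rewrite -ij ih.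
have : (s \o i) \o rho @ i f --> s (i f) by apply: cvg_comp crho _; exact: cs.
apply: cvg_trans; apply: near_eq_cvg; first exact: nbhs_filter (i f).
by apply: (@filterS _ (nbhs (i f))) near_i => h /rhoK /= ->.
Qed.

End embedding.

(** * The carrier space of the Lau product *)

Section lau_characters.
Context (R : realType) (A B : banachAlgType R[i]) (phi : contractive_hom B A).
Local Notation L := (lau phi).

Lemma lau_bmulE (x y : L) : bmul x y =
  (bmul x.1 y.1 + bmul (phi x.2) y.1 + bmul x.1 (phi y.2), bmul x.2 y.2) :> L.
Proof. by []. Qed.

Lemma lau_normE (x : L) : `|x| = `|x.1| + `|x.2|.
Proof. by []. Qed.

(** With the second projection, the coordinates of L in which its product is
    coordinatewise; [lau_inl] and [lau_inr] below are the summands in these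
    coordinates. *)
Definition lau_proj (x : L) : A := x.1 + phi x.2.

Lemma lau_proj_linear : linear lau_proj.
Proof.
by move=> k x y; rewrite /lau_proj /= linearP /= scalerDr addrACA.
Qed.

HB.instance Definition _ := GRing.isLinear.Build R[i] L A *:%R lau_proj
  lau_proj_linear.

Lemma lau_projM (x y : L) : lau_proj (bmul x y) = bmul (lau_proj x) (lau_proj y).
Proof.
by rewrite /lau_proj lau_bmulE /= chomM bmulDl !bmulDr -!addrA; congr (_ + _);
  rewrite addrCA.
Qed.

Lemma ler_norm_lau_proj (x : L) : `|lau_proj x| <= `|x|.
Proof. by rewrite lau_normE (le_trans (ler_normD _ _))// lerD2l ler_chom. Qed.

Definition lau_inl (a : A) : L := (a, 0).
Definition lau_inr (b : B) : L := (- phi b, b).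

Lemma lau_proj_inl a : lau_proj (lau_inl a) = a.
Proof. by rewrite /lau_proj /= linear0 addr0. Qed.

Lemma lau_proj_inr b : lau_proj (lau_inr b) = 0.
Proof. by rewrite /lau_proj /= addNr. Qed.

Definition char_inl (f : carrier_space A) : carrier_space L.
Proof.
apply: (@mk_char _ L (char_val f \o lau_proj)).
- by move=> k x y; rewrite /= !linearP.
- by move=> x y; rewrite /= lau_projM charM.
- have [a a0] := char_neq0 f; exists (lau_inl a); by rewrite /= lau_proj_inl.
Defined.

Definition char_inr (g : carrier_space B) : carrier_space L.
Proof.
apply: (@mk_char _ L (fun x => char_val g x.2)).
- by move=> k x y; rewrite /= !linearP.
- by move=> x y; rewrite /= charM.
- have [b b0] := char_neq0 g; by exists (lau_inr b).
Defined.

Lemma char_inlE f (x : L) : char_val (char_inl f) x = char_val f (lau_proj x).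
Proof. by []. Qed.

Lemma char_inrE g (x : L) : char_val (char_inr g) x = char_val g x.2.
Proof. by []. Qed.

Definition lau_char (w : carrier_space A + carrier_space B) : carrier_space L :=
  match w with inl f => char_inl f | inr g => char_inr g end.

Lemma lau_char_inj : injective lau_char.
Proof.
move=> [f|g] [f'|g'] /= e.
- congr inl; apply: char_inj; apply/funext => a.
  by move: (congr1 (fun h => char_val h (lau_inl a)) e); rewrite !char_inlE lau_proj_inl.
- have [a] := char_neq0 f; move: (congr1 (fun h => char_val h (lau_inl a)) e).
  by rewrite char_inlE char_inrE lau_proj_inl linear0 => ->; rewrite eqxx.
- have [a] := char_neq0 f'; move: (congr1 (fun h => char_val h (lau_inl a)) e).
  by rewrite char_inlE char_inrE lau_proj_inl linear0 => <-; rewrite eqxx.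
- congr inr; apply: char_inj; apply/funext => b.
  by move: (congr1 (fun h => char_val h (lau_inr b)) e); rewrite !char_inrE.
Qed.

(** Let h be a character of L. If h is nonzero at some (a0, 0), its restriction
    f to A is a character, and dividing h ((a, b) (a0, 0)) = f ((a + phi b) a0)
    by f a0 shows that h is induced by f. Otherwise h (a, b) depends only on b,
    and is multiplicative in it because (0, b) (0, b') = (0, b b'). *)
Lemma lau_char_surj (h : carrier_space L) : exists w, lau_char w = h.
Proof.
have [[a0 ha0]|hA] := pselect (exists a, char_val h (lau_inl a) != 0).
  have lf : scalar (fun a => char_val h (lau_inl a)).
    move=> k a a'; rewrite -linearP; congr (char_val h _).
    by congr pair; rewrite /= scaler0 addr0.
  have mf : {morph (fun a => char_val h (lau_inl a)) : x y / bmul x y >-> x * y}.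
    move=> a a'; rewrite -charM lau_bmulE /=; congr (char_val h _).
    by congr pair; rewrite ?linear0 ?bmul0l ?bmul0r ?addr0.
  exists (inl (mk_char lf mf (ex_intro _ a0 ha0))).
  apply: char_inj; apply/funext => x; rewrite char_inlE; apply: (mulIf ha0).
  rewrite /char_val /= -/(char_val h) -!charM; congr (char_val h _).
  rewrite !lau_bmulE /=; congr pair; rewrite ?linear0 ?bmul0l ?bmul0r ?addr0//.
  by rewrite bmulDl.
have {}hA a : char_val h (lau_inl a) = 0.
  by apply/eqP; apply: contra_notT hA => ha; exists a.
have hE x : char_val h x = char_val h ((0, x.2) : L).
  rewrite -[RHS]add0r -(hA x.1) -linearD /=; congr (char_val h _).
  by case: x => a b; congr pair; rewrite /= ?add0r ?addr0.
have lg : scalar (fun b => char_val h ((0, b) : L)).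
  move=> k b b'; rewrite -linearP; congr (char_val h _).
  by congr pair; rewrite /= scaler0 addr0.
have mg : {morph (fun b => char_val h ((0, b) : L)) : x y / bmul x y >-> x * y}.
  move=> b b'; rewrite -charM lau_bmulE /=; congr (char_val h _).
  by congr pair; rewrite ?bmul0l ?bmul0r ?addr0.
have ng : exists b, char_val h ((0, b) : L) != 0.
  by have [x] := char_neq0 h; rewrite hE => ?; exists x.2.
exists (inr (mk_char lg mg ng)).
by apply: char_inj; apply/funext => x; rewrite char_inrE hE.
Qed.

Definition split_char (h : carrier_space L) := sval (cid (lau_char_surj h)).

Lemma split_charK : cancel split_char lau_char.
Proof. by move=> h; exact: svalP (cid (lau_char_surj h)). Qed.

Lemma lau_charK : cancel lau_char split_char.
Proof. by move=> w; apply: lau_char_inj; rewrite split_charK. Qed.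

Lemma lau_semisimple : semisimple A -> semisimple B -> semisimple L.
Proof.
move=> ssA ssB x x0.
have x2 : x.2 = 0 by apply: ssB => g; rewrite -char_inrE x0.
have : lau_proj x = 0 by apply: ssA => f; rewrite -char_inlE x0.
by case: x x2 {x0} => a b /= ->; rewrite /lau_proj /= linear0 addr0 => ->.
Qed.

Lemma lau_commutative : commutative (@bmul R[i] A) -> commutative (@bmul R[i] B) ->
  commutative (@bmul R[i] L).
Proof.
move=> cA cB x y; rewrite !lau_bmulE (cB x.2) (cA x.1 y.1) (cA _ y.1) (cA x.1).
by rewrite addrAC.
Qed.

Lemma char_inl_continuous : continuous char_inl.
Proof.
move=> f; apply: (cvg_carrier (nbhs_filter f)) => x.
exact: (@char_val_continuous _ _ (lau_proj x) f).
Qed.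

Lemma char_inr_continuous : continuous char_inr.
Proof.
move=> f; apply: (cvg_carrier (nbhs_filter f)) => x.
exact: (@char_val_continuous _ _ x.2 f).
Qed.

(** The carrier space of L is the topological disjoint sum of those of A and B:
    [lau_inl] and [lau_inr] separate the two families of characters. *)
Lemma lau_continuousP (s : carrier_space L -> R[i]^o) :
  continuous s <-> continuous (s \o char_inl) /\ continuous (s \o char_inr).
Proof.
split=> [cs|[cA cB] h].
  by split=> f; apply: continuous_comp; [exact: char_inl_continuous|exact: cs|
    exact: char_inr_continuous|exact: cs].
have char_inr_inl g a : char_val (char_inr g) (lau_inl a) = 0.
  by rewrite char_inrE linear0.
have char_inl_inr f b : char_val (char_inl f) (lau_inr b) = 0.
  by rewrite char_inlE lau_proj_inr linear0.
rewrite -(split_charK h); case: (split_char h) => {h} [f|g] /=.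
- apply: (@continuous_at_embedded _ _ _ _ lau_inl) (cA f) => [f' a|h].
    by rewrite char_inlE lau_proj_inl.
  rewrite -(split_charK h); case: (split_char h) => [f'|g']; first by left; exists f'.
  by right => a; rewrite char_inr_inl.
- apply: (@continuous_at_embedded _ _ _ _ lau_inr) (cB g) => [//|h].
  rewrite -(split_charK h); case: (split_char h) => [f'|g']; last by left; exists g'.
  by right => b; rewrite char_inl_inr.
Qed.

(** * Multipliers and BSE functions of the Lau product *)

Lemma lau_inl_linear : linear lau_inl.
Proof. by move=> k a a'; congr pair; rewrite /= scaler0 addr0. Qed.

Lemma lau_inr_linear : linear lau_inr.
Proof. by move=> k b b'; congr pair; rewrite /= linearP scalerN opprD. Qed.

HB.instance Definition _ := GRing.isLinear.Build R[i] A L *:%R lau_inl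
  lau_inl_linear.
HB.instance Definition _ := GRing.isLinear.Build R[i] B L *:%R lau_inr
  lau_inr_linear.

Definition lau_snd (x : L) : B := x.2.
HB.instance Definition _ := GRing.isLinear.Build R[i] L B *:%R lau_snd
  (fun k x y => erefl).

(** Multipliers of L are compressed to the two summands, and multipliers of A
    and B act diagonally on L in the coordinates [lau_proj] and [lau_snd]. *)
Lemma multiplier_transforms_lauP (s : carrier_space L -> R[i]) :
  semisimple A -> semisimple B ->
  multiplier_transforms L s <->
  multiplier_transforms A (s \o char_inl) /\ multiplier_transforms B (s \o char_inr).
Proof.
move=> ssA ssB; split.
  move=> [T _ [/lau_continuousP[csA csB] Ts]]; split.
  - have TsA c f : char_val f ((lau_proj \o T \o lau_inl) c) =
        (s \o char_inl) f * char_val f c.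
      by rewrite /= -char_inlE Ts char_inlE lau_proj_inl.
    exists (lau_proj \o T \o lau_inl : {linear A -> A}) => //.
    exact: char_multiplier TsA.
  - have TsB c g : char_val g ((lau_snd \o T \o lau_inr) c) =
        (s \o char_inr) g * char_val g c.
      by rewrite /= -char_inrE Ts char_inrE.
    exists (lau_snd \o T \o lau_inr : {linear B -> B}) => //.
    exact: char_multiplier TsB.
move=> [[TA _ [csA TsA]] [TB _ [csB TsB]]].
pose T : {linear L -> L} := 
  (lau_inl \o TA \o lau_proj) \+ (lau_inr \o TB \o lau_snd).
have Ts x h : char_val h (T x) = s h * char_val h x.
  rewrite -(split_charK h) linearD /=; case: (split_char h) => [f|g].
  - by rewrite !char_inlE lau_proj_inl lau_proj_inr linear0 addr0 TsA.
  - by rewrite !char_inrE linear0 add0r TsB.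
exists T; first exact: char_multiplier (lau_semisimple ssA ssB) _ _ Ts.
by split=> //; apply/lau_continuousP.
Qed.

(** From L to the summands the constant is unchanged, since the two coordinates
    are contractive. Back, a combination of characters of L is evaluated on each
    summand separately, where only one of the two families survives; the second
    summand is embedded with norm at most 2, whence the constant k + 2 l. *)
Lemma C_BSE_lauP (s : carrier_space L -> R[i]) :
  C_BSE L s <-> C_BSE A (s \o char_inl) /\ C_BSE B (s \o char_inr).
Proof.
split=> [[/lau_continuousP[csA csB] [k k0 sk]]|].
  split; split=> //; exists k => // n f c.
  - apply: le_trans (sk n (char_inl \o f) c) _; rewrite lee_pmul2l// -[leRHS]mul1e.
    apply: (@le_dual_norm _ _ _ _ lau_proj) => // x; first exact: ler_norm_lau_proj.
    by rewrite mul1r.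
  - apply: le_trans (sk n (char_inr \o f) c) _; rewrite lee_pmul2l// -[leRHS]mul1e.
    apply: (@le_dual_norm _ _ _ _ lau_snd) => // x; last by rewrite mul1r.
    by rewrite lau_normE lerDr.
move=> [[csA [k k0 sk]] [csB [l l0 sl]]].
split; first exact/lau_continuousP.
exists (k + 2 * l) => [|n h c]; first by rewrite addr_gt0 ?mulr_gt0.
pose fA j := if split_char (h j) is inl f then Some f else None.
pose fB j := if split_char (h j) is inr g then Some g else None.
set F := (fun x : L => _).
have FZ a x : F (a *: x) = a * F x.
  by rewrite /F mulr_sumr; apply: eq_bigr => j _; rewrite linearZ mulrCA.
have -> : \sum_(j < n) c j * s (h j) = \sum_(j < n) c j * oapp (s \o char_inl) 0 (fA j) +
    \sum_(j < n) c j * oapp (s \o char_inr) 0 (fB j).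
  rewrite -big_split /=; apply: eq_bigr => j _; rewrite -mulrDr -{1}(split_charK (h j)).
  by rewrite /fA /fB; case: (split_char _) => [f|g] /=; rewrite ?addr0 ?add0r.
have FA a : F (lau_inl a) = \sum_(j < n) c j * oapp (@char_val R A ^~ a) 0 (fA j).
  apply: eq_bigr => j _; rewrite -{1}(split_charK (h j)) /fA.
  by case: (split_char _) => [f|g]; rewrite /= ?char_inlE ?lau_proj_inl// char_inrE linear0.
have FB b : F (lau_inr b) = \sum_(j < n) c j * oapp (@char_val R B ^~ b) 0 (fB j).
  apply: eq_bigr => j _; rewrite -{1}(split_charK (h j)) /fB.
  by case: (split_char _) => [f|g]; rewrite /= ?char_inlE ?lau_proj_inr ?linear0.
apply: le_trans (_ : (complex.Re _)%:E + (complex.Re _)%:E <= _)%E.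
  by rewrite -EFinD lee_fin; exact: Re_normD.
rewrite EFinD ge0_muleDl ?lee_fin ?mulr_ge0 ?(ltW k0) ?(ltW l0)//.
apply: leeD.
  apply: le_trans (BSE_bound_option fA c k0 sk) _; rewrite lee_pmul2l// -[leRHS]mul1e.
  apply: (@le_dual_norm _ _ _ _ lau_inl) => // a; last by rewrite mul1r FA.
  by rewrite lau_normE /= normr0 addr0.
apply: le_trans (BSE_bound_option fB c l0 sl) _.
rewrite mulrC EFinM -muleA lee_pmul2l//.
(* [lau_inr] is contractive only after halving. *)
apply: (@le_dual_norm _ _ _ _ (fun b => lau_inr (2^-1 *: b))) => // b.
  rewrite lau_normE /= normrN linearZ /= !normrZ -mulrDr ger0_norm ?invr_ge0//.
  by rewrite ler_pdivrMl// mulr_natl mulr2n lerD2r ler_chom.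
rewrite -FB linearZ FZ mulrA.
have -> : 2%:C%C = 2 :> R[i] by exact: rmorph_nat (real_complex R) 2.
by rewrite mulfV ?mul1r ?pnatr_eq0.
Qed.

End lau_characters.

Lemma BSE_algebra_semisimple (R : realType) (C : banachAlgType R[i]) :
  commutative (@bmul R[i] C) -> semisimple C ->
  BSE_algebra C <-> forall s, C_BSE C s <-> multiplier_transforms C s.
Proof.
move=> cC ssC; split=> [[_ _ ->]//|CM].
by split=> //; [exact: semisimple_without_order|apply/seteqP; split=> s /CM].
Qed.

Theorem theorem4p3 (R : realType) (A B : banachAlgType R[i])
    (comA : commutative (@bmul R[i] A)) (comB : commutative (@bmul R[i] B))
    (ssA : semisimple A) (ssB : semisimple B)
    (phi : contractive_hom B A) :
  BSE_algebra (lau phi) <-> BSE_algebra A /\ BSE_algebra B.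
Proof.
have comL := lau_commutative (phi := phi) comA comB.
have ssL := lau_semisimple (phi := phi) ssA ssB.
rewrite !BSE_algebra_semisimple//; split=> [CM|[CMA CMB] s].
  (* Extending by 0 is gluing with the constant function 0. *)
  pose glue (sA : carrier_space A -> R[i]) (sB : carrier_space B -> R[i]) h :=
    match @split_char _ _ _ phi h with inl f => sA f | inr g => sB g end.
  have glueA sA sB : glue sA sB \o @char_inl _ _ _ phi = sA.
    by apply/funext => f; rewrite /glue /= (lau_charK phi (inl f)).
  have glueB sA sB : glue sA sB \o @char_inr _ _ _ phi = sB.
    by apply/funext => g; rewrite /glue /= (lau_charK phi (inr g)).
  have CML sA sB : C_BSE A sA /\ C_BSE B sB <->
      multiplier_transforms A sA /\ multiplier_transforms B sB.
    have := CM (glue sA sB).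
    by rewrite C_BSE_lauP multiplier_transforms_lauP// glueA glueB.
  split=> s; split=> [Cs|Ms].
  - by have [+ _] := CML s (fun=> 0) => /(_ (conj Cs (C_BSE0 B)))[].
  - by have [_] := CML s (fun=> 0) => /(_ (conj Ms (multiplier_transforms0 B)))[].
  - by have [+ _] := CML (fun=> 0) s => /(_ (conj (C_BSE0 A) Cs))[].
  - by have [_] := CML (fun=> 0) s => /(_ (conj (multiplier_transforms0 A) Ms))[].
by rewrite C_BSE_lauP multiplier_transforms_lauP// CMA CMB.
Qed.
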